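(* Let $n\ge 1$ be an integer and let $f$ be the in-shuffle permutation of $\{1,2,\dots,2n\}$. The period of the in-shuffle of $2n$ cards (i.e. the period of $f$) is the smallest integer $r\ge 1$ such that $2^r\equiv 1 \pmod{2n+1}$. In other words, it is the order of $2$ modulo $2n+1$.
   Context: A deck of $2n$ cards numbered $1,2,\dots,2n$ from bottom to top is cut into the packets $1,\dots,n$ and $n+1,\dots,2n$. The in-shuffle interleaves them perfectly, starting with the second packet, giving from bottom to top the cards $n+1,1,n+2,2,\dots,2n,n$. It is described by the permutation $f$ of $\{1,\dots,2n\}$ where $f(i)$ is the number of the card at position $i$ after the shuffle: $f(i)=i/2$ if $i$ is even, and $f(i)=(i+1)/2+n$ if $i$ is odd. The period of a permutation $\sigma$ of a finite set is the smallest integer $r\ge 1$ such that $\sigma^r=\mathrm{id}$ ($r$-fold composition); the period of a shuffle is the period of its permutation. *)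

(* Defs.v *)
From mathcomp Require Import all_boot all_fingroup all_algebra.
From mathcomp Require Import zify.

Set Implicit Arguments.
Unset Strict Implicit.
Unset Printing Implicit Defensive.

Local Open Scope nat_scope.

(* {1, ..., 2n}, realised inside {0, ..., 2n}; for [i : deck n] the number *)
(* itself is [val (val i)].                                                *)
Definition deck (n : nat) := {i : 'I_(2 * n).+1 | 0 < i}.

Definition in_shuffle_num (n i : nat) : nat :=
  if odd i then i.+1 %/ 2 + n else i %/ 2.

Lemma in_shuffle_num_le (n i : nat) :
  0 < i -> i < (2 * n).+1 -> in_shuffle_num n i < (2 * n).+1.
Proof. by rewrite /in_shuffle_num; case: ifP; lia. Qed.

Lemma in_shuffle_num_gt0 (n i : nat) : 0 < i -> 0 < in_shuffle_num n i.
Proof. by rewrite /in_shuffle_num; case: ifP; lia. Qed.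

Definition in_shuffle_fun (n : nat) (i : deck n) : deck n :=
  Sub (Ordinal (in_shuffle_num_le (valP i) (ltn_ord (val i))))
      (in_shuffle_num_gt0 n (valP i)).

Lemma in_shuffle_inj (n : nat) : injective (@in_shuffle_fun n).
Proof.
move=> [[i lti] /= i_gt0] [[j ltj] /= j_gt0].
move=> /(congr1 (fun k : deck n => val (val k))) /= eq_ij.
apply/val_inj/val_inj => /=; move: eq_ij.
by rewrite /in_shuffle_num; case: ifP; case: ifP; lia.
Qed.

Definition in_shuffle (n : nat) : {perm deck n} := perm (@in_shuffle_inj n).

Lemma period_exists (T : finType) (s : {perm T}) :
  exists r, (0 < r) && (s ^+ r == 1)%g.
Proof. by exists #[s]%g; rewrite order_gt0 expg_order eqxx. Qed.

Definition period (T : finType) (s : {perm T}) : nat :=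
  ex_minn (period_exists s).

(* Main.v *)
Require Import Defs.
From mathcomp Require Import all_boot all_fingroup all_algebra.
From mathcomp Require Import cyclic zify.

(* The inverse of the in-shuffle is multiplication by 2 modulo 2n+1.  Hence its
   r-th power is the identity iff 2^r fixes every nonzero residue, and the
   residue 1 already detects this. *)

(** The shuffle [f] halves residues modulo [2n+1], so [f^r] divides by [2^r]; thus [f^r = id] iff
    [2^r] is 1 modulo [2n+1] ([in_shuffleX_eq1]). Powers of the unit 2 obey the same criterion
    ([unit_ZpX_eq1]), so both orders agree. *)

Lemma period_order (T : finType) (s : {perm T}) : period s = #[s]%g.
Proof.
rewrite /period; case: ex_minnP => r /andP[r_gt0 sr1] r_min.
apply/eqP; rewrite eqn_leq r_min ?order_gt0 ?expg_order ?eqxx //=.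
by rewrite dvdn_leq // order_dvdn.
Qed.

Lemma double_in_shuffle (n : nat) (i : deck n) :
  2 * val (val (in_shuffle n i)) = val (val i) %[mod (2 * n).+1].
Proof.
rewrite permE /= /in_shuffle_num; set k := nat_of_ord _.
case: ifP => odd_k; last by congr (_ %% _); lia.
have -> : 2 * (k.+1 %/ 2 + n) = k + (2 * n).+1 by lia.
by rewrite modnDr.
Qed.

Lemma expn2_in_shuffleX (n r : nat) (i : deck n) :
  2 ^ r * val (val ((in_shuffle n ^+ r)%g i)) = val (val i) %[mod (2 * n).+1].
Proof.
elim: r => [|r IHr]; first by rewrite expg0 perm1 mul1n.
(* The last shuffle applied absorbs one factor 2. *)
rewrite expgSr permM expnSr -mulnA -modnMmr double_in_shuffle modnMmr.
exact: IHr.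
Qed.

Lemma in_shuffleX_eq1 (n r : nat) : 0 < n ->
  (in_shuffle n ^+ r == 1)%g = (2 ^ r == 1 %[mod (2 * n).+1]).
Proof.
move=> n_gt0; apply/eqP/eqP => [fr1 | exp2r1].
  have lt1 : 1 < (2 * n).+1 by lia.
  have /= := @expn2_in_shuffleX n r (Sub (Ordinal lt1) isT).
  by rewrite fr1 perm1 /= muln1.
apply/permP => i; rewrite perm1; apply/val_inj/val_inj => /=.
have := @expn2_in_shuffleX n r i.
(* Deck entries are below [2n+1], so congruence is equality. *)
by rewrite -modnMml exp2r1 modnMml mul1n !modn_small ?ltn_ord.
Qed.

(** The type ['Z_m] always has modulus at least 2; [1 < m] makes that modulus [m] itself. *)
Lemma unit_ZpX_eq1 (m a r : nat) (u : {unit 'Z_m}) : 1 < m ->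
  val u = (a%:R)%R -> (u ^+ r == 1)%g = (a ^ r == 1 %[mod m]).
Proof.
move=> m_gt1 u_a; rewrite -val_eqE FinRing.val_unitX FinRing.val_unit1.
by rewrite u_a -GRing.natrX -val_eqE /= val_Zp_nat // Zp_cast.
Qed.

Theorem mainTheorem1 (n : nat) (hn : (1 <= n)%N) :
  [/\ (1 <= period (in_shuffle n))%N,
      (2 ^ period (in_shuffle n) = 1 %[mod (2 * n).+1])%N
    & forall r : nat, (1 <= r)%N -> (2 ^ r = 1 %[mod (2 * n).+1])%N ->
        (period (in_shuffle n) <= r)%N]
  /\ (exists2 u : {unit 'Z_(2 * n).+1},
        val u = (2%:R)%R & period (in_shuffle n) = #[u]%g).
Proof.
have m_gt1 : 1 < (2 * n).+1 by lia.
rewrite period_order; split; first split.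
- exact: order_gt0.
- by apply/eqP; rewrite -in_shuffleX_eq1 // expg_order.
- move=> r r_gt0 /eqP; rewrite -in_shuffleX_eq1 // -order_dvdn.
  exact: dvdn_leq.
have unit2 : (2%:R : 'Z_(2 * n).+1)%R \is a GRing.unit.
  by rewrite unitZpE // coprimen2 /= mul2n odd_double.
exists (FinRing.unit _ unit2) => //.
(* Mutual divisibility: each element raised to the other's order is 1, by the shared criterion. *)
apply/eqP; rewrite eqn_dvd !order_dvdn in_shuffleX_eq1 //.
rewrite -(@unit_ZpX_eq1 _ _ _ (FinRing.unit _ unit2)) // expg_order eqxx /=.
by rewrite (@unit_ZpX_eq1 _ 2) // -in_shuffleX_eq1 // expg_order.
Qed.
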